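(* Let $I\subset(0,\infty)$ be an open interval, let $p\colon I\to\mathbb{R}$ be smooth with $p'(\rho)>0$, and put $A(\rho)=\rho^{-1}\sqrt{p'(\rho)}$. Let $Q=\int\rho A^2\,d\rho$ be a fixed antiderivative of $\rho A^2(\rho)$ on $I$ and let $\int Q\,d\rho$ denote a fixed antiderivative of $Q$ on $I$. Let $\lambda\neq 0$, $\alpha_0,\alpha_2,t_0,x_0$ be real constants and let $N\subset\mathbb{R}^4(t,x,u,\rho)$ be the two-dimensional manifold given by (with $u\in\mathbb{R}$, $\rho\in I$) $$t=\frac{\lambda u^{2}}{2}+\alpha_{0}u+\frac{\alpha_{2}}{\rho}+\frac{\lambda}{\rho}\int Q\,d\rho+t_{0},$$ $$x=\frac{\lambda u^{3}}{3}-\lambda uQ+\frac{\alpha_{0}u^{2}}{2}+\frac{\lambda u}{\rho}\int Q\,d\rho+\frac{\alpha_{2}u}{\rho}-\alpha_{0}Q+x_{0}.$$ Then the caustic of $N$ is given by the parametric equations (with parameter $\rho\in I$, one curve for the upper signs and one for the lower signs, with the same function $t(\rho)$ for both) $$x(\rho)=x_{0}-\frac{Z_{\pm}^{3}}{3\lambda^{2}A^{3}\rho^{6}}+\frac{\alpha_{0}Z_{\pm}^{2}}{2\lambda^{2}A^{2}\rho^{4}}\pm\frac{\alpha_{0}Z_{\pm}}{\lambda\rho}\mp\frac{Z_{\pm}^{2}}{\lambda A\rho^{3}}-\alpha_{0}Q,$$ $$t(\rho)=\frac{Z_{+}^{2}}{2\lambda A^{2}\rho^{4}}+\frac{Z_{+}}{\rho}\left(1-\frac{\alpha_{0}}{\lambda\rho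 A}\right)-\alpha_{0}\rho A+\lambda Q+t_{0},$$ where $$Z_{\pm}=\alpha_{0}\rho^{2}A\mp\lambda\rho Q\pm\lambda\int Q\,d\rho\pm\alpha_{2}.$$
   Context: The manifold $N$ is a multivalued solution of the one-dimensional Euler system $\rho_t+(\rho u)_x=0$, $u_t+uu_x+\frac{p'(\rho)}{\rho}\rho_x=0$. The caustic of $N$ is the image, under the projection $(t,x,u,\rho)\mapsto(t,x)$ to the plane of independent variables, of the set of points of $N$ at which the restriction $(dx\wedge dt)|_N$ vanishes, i.e. where the projection of $N$ to the $(t,x)$-plane is singular. *)

(* Defs.v *)
From mathcomp Require Import all_boot all_order all_algebra.
From mathcomp Require Import all_classical all_reals all_analysis.
Set Implicit Arguments.
Unset Strict Implicit.
Unset Printing Implicit Defensive.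
Import Order.TTheory GRing.Theory Num.Theory.
Import numFieldNormedType.Exports.
Local Open Scope classical_set_scope.
Local Open Scope ring_scope.

Section R4.
Variable R : realType.
Implicit Types (N : set 'rV[R]_4) (m v w : 'rV[R]_4).

(* R^4(t, x, u, rho); the numerals 0, ..., 3 are elements of 'I_4. *)
Definition tcoord m : R := m 0 0.
Definition xcoord m : R := m 0 1.
Definition ucoord m : R := m 0 2.
Definition rcoord m : R := m 0 3.

(* Velocities at m of the curves lying in N.  When N is an embedded
   submanifold, this is its tangent space T_m N; differentiability of the
   curve at the point m alone already gives all of T_m N and nothing more. *)
Definition tangent N m : set 'rV[R]_4 :=
  [set v | exists gamma : R -> 'rV[R]_4,
     [/\ gamma 0 = m,
         \forall s \near (0 : R), N (gamma s)
       & is_derive (0 : R) (1 : R) gamma v]].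

Definition dx_wedge_dt v w : R :=
  xcoord v * tcoord w - xcoord w * tcoord v.

(* The points of N at which the restriction of dx /\ dt to N vanishes. *)
Definition singular_points N : set 'rV[R]_4 :=
  [set m | N m /\ forall v w, tangent N m v -> tangent N m w ->
                    dx_wedge_dt v w = 0].

Definition caustic N : set (R * R) :=
  [set (tcoord m, xcoord m) | m in singular_points N].

End R4.

(* Functions on I are represented by total functions; since I is open in all
   uses, derivatives at points of I only depend on the restriction to I. *)
Definition smooth_on (R : realType) (I : set R) (f : R -> R) : Prop :=
  forall (n : nat) (x : R), I x -> derivable (derive1n n f) x 1.

Definition antiderivative_on (R : realType) (I : set R) (f F : R -> R) : Prop :=
  forall x : R, I x -> is_derive x (1 : R) F (f x).

(* Main.v *)
Require Import Defs.
From mathcomp Require Import all_boot all_order all_algebra.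
From mathcomp Require Import ring.
From mathcomp Require Import all_classical all_reals all_analysis.
Import Order.TTheory GRing.Theory Num.Theory.
Import numFieldNormedType.Exports.
Local Open Scope classical_set_scope.
Local Open Scope ring_scope.

Set Implicit Arguments.
Unset Strict Implicit.
Unset Printing Implicit Defensive.

(* In the coordinates (u, rho) of N one has t_u = lambda u + alpha0 and
   t_rho = - K / rho^2 with K = alpha2 + lambda int Q - lambda rho Q, and
   x_u t_rho - x_rho t_u = rho A^2 t_u^2 - K^2 / rho^3 splits into two factors
   that are affine in u.  Hence the singular points are the two curves
   u = - Z_s / (lambda rho^2 A), s = 1, -1, and substituting u in t and x gives
   the caustic.  Both curves have the same t because t depends on u only
   through (lambda u + alpha0)^2 = (K / (rho^2 A))^2. *)

Lemma is_derive_mxP (R : realFieldType) (V : normedModType R) (m n : nat)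
    (M : V -> 'M[R]_(m, n)) (t v : V) (D : 'M[R]_(m, n)) :
  is_derive t v M D <-> forall i j, is_derive t v (fun x => M x i j) (D i j).
Proof.
split=> [[Md <-] i j|Mij].
  by split; [exact: (derivable_mxP _ _ _).1|rewrite derive_mx// mxE].
have Md : derivable M t v by apply/derivable_mxP => i j; case: (Mij i j).
split=> //; rewrite derive_mx//; apply/matrixP => i j; rewrite mxE.
by case: (Mij i j).
Qed.

(* Weak differentiability of F at (u, r), with partial derivatives Fu and Fr:
   the chain rule holds along every curve differentiable at the parameter 0. *)
Definition chain_rule_at (R : realType) (F : R -> R -> R) (u r Fu Fr : R) :=
  forall (gu gr : R -> R) (a b : R), gu 0 = u -> gr 0 = r ->
    is_derive (0 : R) (1 : R) gu a -> is_derive (0 : R) (1 : R) gr b ->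
    is_derive (0 : R) (1 : R) (fun s => F (gu s) (gr s)) (Fu * a + Fr * b).

Definition graph_over (R : realType) (I : set R) (T X : R -> R -> R) :
    set 'rV[R]_4 :=
  [set m | [/\ I (rcoord m), tcoord m = T (ucoord m) (rcoord m)
             & xcoord m = X (ucoord m) (rcoord m)]].

(** Along a curve in the graph, t and x coincide near 0 with [T] and [X] of the remaining two
    coordinates, so the chain rule fixes their velocities. Conversely, a straight line in the (u,
    rho)-plane lifts to the graph; as [I] is open, the lift stays in the graph near 0. *)
Lemma tangent_graph (R : realType) (I : set R) (T X : R -> R -> R)
    (m v : 'rV[R]_4) (Tu Tr Xu Xr : R) :
  open I -> graph_over I T X m ->
  chain_rule_at T (ucoord m) (rcoord m) Tu Tr ->
  chain_rule_at X (ucoord m) (rcoord m) Xu Xr ->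
  tangent (graph_over I T X) m v <->
  tcoord v = Tu * ucoord v + Tr * rcoord v /\
  xcoord v = Xu * ucoord v + Xr * rcoord v.
Proof.
move=> Iopen [Im tm xm] dT dX; split.
  move=> [g [g0 gN /is_derive_mxP dg]].
  have du := dg 0 2; have dr := dg 0 3.
  have {}dT := dT _ _ _ _ (congr1 (@ucoord R) g0) (congr1 (@rcoord R) g0) du dr.
  have {}dX := dX _ _ _ _ (congr1 (@ucoord R) g0) (congr1 (@rcoord R) g0) du dr.
  split.
    have Tg : \forall s \near (0 : R),
        T (ucoord (g s)) (rcoord (g s)) = g s 0 0.
      by apply: filterS gN => s [_ <-].
    have [_ <-] := near_eq_is_derive Tg dT.
    by rewrite /tcoord; have [_ <-] := dg 0 0.
  have Xg : \forall s \near (0 : R), X (ucoord (g s)) (rcoord (g s)) = g s 0 1.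
    by apply: filterS gN => s [_ _ <-].
  have [_ <-] := near_eq_is_derive Xg dX.
    by rewrite /xcoord; have [_ <-] := dg 0 1.
move=> [tv xv].
pose gu s := ucoord m + s * ucoord v.
pose gr s := rcoord m + s * rcoord v.
pose c s := [:: T (gu s) (gr s); X (gu s) (gr s); gu s; gr s].
have gu0 : gu 0 = ucoord m by rewrite /gu mul0r addr0.
have gr0 : gr 0 = rcoord m by rewrite /gr mul0r addr0.
have line (a b : R) : is_derive (0 : R) (1 : R) (fun s => a + s * b) b.
  have := is_deriveD (is_derive_cst a (0 : R) 1)
    (is_deriveM (is_derive_id (0 : R) 1) (is_derive_cst b (0 : R) 1)).
  by rewrite scaler0 !add0r [_ *: _]mulr1.
exists (fun s => \row_(j < 4) nth 0 (c s) j); split.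
(* The destructed index and the numeral of ['I_4] may differ in their bound proofs, hence
   [val_inj]. *)
- apply/rowP => -[[|[|[|[|//]]]] jlt]; rewrite mxE /= ?gu0 ?gr0 -?tm -?xm;
    by congr (m _ _); apply/val_inj.
- have : \forall s \near (0 : R), I (gr s).
    have cgr : {for 0, continuous gr}.
      apply/differentiable_continuous/derivable1_diffP.
      by case: (line (rcoord m) (rcoord v)).
    by apply: cgr; rewrite gr0; exact: open_nbhs_nbhs.
  by apply: filterS => s Is; split; rewrite /rcoord/tcoord/xcoord/ucoord !mxE.
- apply/is_derive_mxP => i j; rewrite (ord1 i) {i}.
  have du := line (ucoord m) (ucoord v); have dr := line (rcoord m) (rcoord v).
  have := dX _ _ _ _ gu0 gr0 du dr; have := dT _ _ _ _ gu0 gr0 du dr.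
  rewrite -tv -xv; move: j du dr => -[[|[|[|[|//]]]] jlt] du dr dt dx.
  + under eq_fun do rewrite mxE.
    by apply: is_derive_eq dt _; congr (v _ _); apply/val_inj.
  + under eq_fun do rewrite mxE.
    by apply: is_derive_eq dx _; congr (v _ _); apply/val_inj.
  + under eq_fun do rewrite mxE.
    by apply: is_derive_eq du _; congr (v _ _); apply/val_inj.
  + under eq_fun do rewrite mxE.
    by apply: is_derive_eq dr _; congr (v _ _); apply/val_inj.
Qed.

(** Tangent vectors are parametrized freely by their u and rho components, and in these components
    the restricted form is the Jacobian times du /\ drho. Evaluating it on the basis vectors [w 1 0]
    and [w 0 1] returns the Jacobian itself. *)
Lemma singular_points_graph (R : realType) (I : set R) (T X : R -> R -> R)
    (m : 'rV[R]_4) (Tu Tr Xu Xr : R) :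
  open I -> graph_over I T X m ->
  chain_rule_at T (ucoord m) (rcoord m) Tu Tr ->
  chain_rule_at X (ucoord m) (rcoord m) Xu Xr ->
  singular_points (graph_over I T X) m <-> Xu * Tr - Xr * Tu = 0.
Proof.
move=> Iopen mN dT dX; have tgt v := tangent_graph v Iopen mN dT dX.
split=> [[_ sing]|det0].
  pose w a b : 'rV[R]_4 :=
    \row_(j < 4) nth 0 [:: Tu * a + Tr * b; Xu * a + Xr * b; a; b] j.
  have tw a b : tangent (graph_over I T X) m (w a b).
    by apply/tgt; rewrite /tcoord/xcoord/ucoord/rcoord !mxE.
  have := sing _ _ (tw 1 0) (tw 0 1).
  by rewrite /dx_wedge_dt/tcoord/xcoord !mxE /= !(mulr1, mulr0, addr0, add0r).
split=> // v w /tgt[tv xv] /tgt[tw xw]; rewrite /dx_wedge_dt tv xv tw xw.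
rewrite (_ : _ - _ = (Xu * Tr - Xr * Tu) *
  (ucoord v * rcoord w - ucoord w * rcoord v)); last by ring.
by rewrite det0 mul0r.
Qed.

Section EulerSolution.
Variables (R : realType) (I : set R) (A Q J : R -> R).
Variables (lambda alpha0 alpha2 t0 x0 : R).
Hypotheses (Ipos : forall r, I r -> 0 < r)
  (dQ : antiderivative_on I (fun r => r * A r ^+ 2) Q)
  (dJ : antiderivative_on I Q J).

Definition tsol (u r : R) : R :=
  lambda * u ^+ 2 / 2 + alpha0 * u + alpha2 / r + lambda / r * J r + t0.

Definition xsol (u r : R) : R :=
  lambda * u ^+ 3 / 3 - lambda * u * Q r + alpha0 * u ^+ 2 / 2
  + lambda * u / r * J r + alpha2 * u / r - alpha0 * Q r + x0.

(** The double sign becomes a real parameter [s], to be taken equal to 1 or -1. With [K] as below,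
    [zsol s r] is [alpha0 * r ^+ 2 * A r + s * K r]. *)
Definition zsol (s r : R) : R :=
  alpha0 * r ^+ 2 * A r - s * (lambda * r * Q r) + s * (lambda * J r)
  + s * alpha2.

Let K r := alpha2 + lambda * J r - lambda * r * Q r.

Lemma tsol_chain_rule_at (u r : R) : I r ->
  chain_rule_at tsol u r (lambda * u + alpha0) (- (K r / r ^+ 2)).
Proof.
move=> Ir gu gr a b gu0 gr0 du dr; have r0 := lt0r_neq0 (Ipos Ir).
have di : is_derive (0 : R) (1 : R) (fun s => (gr s)^-1) (- r ^- 2 * b).
  by rewrite -gr0; apply: is_deriveV => //; rewrite gr0.
have dJr : is_derive (0 : R) (1 : R) (J \o gr) (Q r * b).
  by apply: is_derive1_comp; rewrite gr0; exact: dJ.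
(* The terms with denominator r are grouped as (alpha2 + lambda J) / r, whose derivative in r is
   lambda Q / r - (alpha2 + lambda J) / r^2 = - K / r^2. *)
have := is_deriveD (is_deriveD (is_deriveZ (lambda / 2) (is_deriveX 2 du))
  (is_deriveZ alpha0 du)) (is_deriveD (is_deriveM di
  (is_deriveD (is_derive_cst alpha2 (0 : R) (1 : R)) (is_deriveZ lambda dJr)))
  (is_derive_cst t0 (0 : R) (1 : R))).
set f := (f in is_derive _ _ f _) => df.
have -> : (fun s => tsol (gu s) (gr s)) = f.
  by apply/funext => s; rewrite /f /tsol !fctE /= /GRing.scale /=; ring.
apply: is_derive_eq df _; rewrite /= !fctE /= !gu0 !gr0 /K /GRing.scale /=.
by field.
Qed.

(** Here x_u = u t_u + K / r and x_rho = u t_rho - rho A^2 t_u; in this form the terms u t_u t_rho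
    cancel in the Jacobian. The proof groups the terms with [Q] as - (lambda u + alpha0) Q. *)
Lemma xsol_chain_rule_at (u r : R) : I r ->
  chain_rule_at xsol u r (u * (lambda * u + alpha0) + K r / r)
    (- (u * K r / r ^+ 2) - (lambda * u + alpha0) * (r * A r ^+ 2)).
Proof.
move=> Ir gu gr a b gu0 gr0 du dr; have r0 := lt0r_neq0 (Ipos Ir).
have di : is_derive (0 : R) (1 : R) (fun s => (gr s)^-1) (- r ^- 2 * b).
  by rewrite -gr0; apply: is_deriveV => //; rewrite gr0.
have dJr : is_derive (0 : R) (1 : R) (J \o gr) (Q r * b).
  by apply: is_derive1_comp; rewrite gr0; exact: dJ.
have dQr : is_derive (0 : R) (1 : R) (Q \o gr) (r * A r ^+ 2 * b).
  by apply: is_derive1_comp; rewrite gr0; exact: dQ.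
have dT := is_deriveD (is_deriveZ lambda du)
  (is_derive_cst alpha0 (0 : R) (1 : R)).
have := is_deriveD (is_deriveD (is_deriveZ (lambda / 3) (is_deriveX 3 du))
  (is_deriveZ (alpha0 / 2) (is_deriveX 2 du)))
  (is_deriveD (is_deriveB (is_deriveM (is_deriveM du di)
    (is_deriveD (is_derive_cst alpha2 (0 : R) (1 : R)) (is_deriveZ lambda dJr)))
    (is_deriveM dT dQr)) (is_derive_cst x0 (0 : R) (1 : R))).
set f := (f in is_derive _ _ f _) => df.
have -> : (fun s => xsol (gu s) (gr s)) = f.
  by apply/funext => s; rewrite /f /xsol !fctE /= /GRing.scale /=; ring.
apply: is_derive_eq df _; rewrite /= !fctE /= !gu0 !gr0 /K /GRing.scale /=.
by field.
Qed.

Hypotheses (Iopen : open I) (Apos : forall r, I r -> 0 < A r)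
  (lambda0 : lambda != 0).

(** This is the solution u of lambda u + alpha0 = - s K / (r^2 A), the vanishing condition of one
    affine factor of the Jacobian. *)
Definition usol (s r : R) : R := - zsol s r / (lambda * r ^+ 2 * A r).

Lemma singular_points_sol (m : 'rV[R]_4) : graph_over I tsol xsol m ->
  singular_points (graph_over I tsol xsol) m <->
  ucoord m = usol 1 (rcoord m) \/ ucoord m = usol (-1) (rcoord m).
Proof.
move=> mN; have [Ir _ _] := mN; set u := ucoord m; set r := rcoord m.
have r0 := lt0r_neq0 (Ipos Ir); have A0 := lt0r_neq0 (Apos Ir).
have dT := tsol_chain_rule_at (u := u) Ir.
have dX := xsol_chain_rule_at (u := u) Ir.
have := singular_points_graph Iopen mN dT dX.
move=> h; apply: (iff_trans h) => {h}.
(* Each affine factor lambda u + alpha0 + s K / (r^2 A) equals lambda (u - [usol s r]), whence the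
   prefactor, which is nonzero. *)
have -> : (u * (lambda * u + alpha0) + K r / r) * - (K r / r ^+ 2) -
    (- (u * K r / r ^+ 2) - (lambda * u + alpha0) * (r * A r ^+ 2)) *
    (lambda * u + alpha0)
  = lambda ^+ 2 * r * A r ^+ 2 * ((u - usol 1 r) * (u - usol (-1) r)).
  by rewrite /usol /zsol /K; field; rewrite r0 lambda0 A0.
split=> [/eqP|[->|->]]; last 2 first.
- by rewrite subrr mul0r mulr0.
- by rewrite subrr !mulr0.
rewrite !mulf_eq0 /= (negPf lambda0) (negPf r0) (negPf A0) /=.
by rewrite !subr_eq0 => /orP[] /eqP; [left|right].
Qed.

End EulerSolution.

Theorem mainTheorem2 (R : realType) (I : set R) (p Q intQ : R -> R)
    (lambda alpha0 alpha2 t0 x0 : R) :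
  let A := fun rho : R => rho^-1 * Num.sqrt (derive1 p rho) in
  let N := [set m : 'rV[R]_4 |
    let t := tcoord m in let x := xcoord m in
    let u := ucoord m in let rho := rcoord m in
    [/\ I rho,
        t = lambda * u ^+ 2 / 2 + alpha0 * u + alpha2 / rho
            + lambda / rho * intQ rho + t0
      & x = lambda * u ^+ 3 / 3 - lambda * u * Q rho + alpha0 * u ^+ 2 / 2
            + lambda * u / rho * intQ rho + alpha2 * u / rho
            - alpha0 * Q rho + x0]] in
  (* s = 1 for the upper signs, s = -1 for the lower signs *)
  let Z := fun s rho : R =>
    alpha0 * rho ^+ 2 * A rho - s * (lambda * rho * Q rho)
    + s * (lambda * intQ rho) + s * alpha2 in
  let xcurve := fun s rho : R =>
    x0 - Z s rho ^+ 3 / (3 * lambda ^+ 2 * A rho ^+ 3 * rho ^+ 6)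
    + alpha0 * Z s rho ^+ 2 / (2 * lambda ^+ 2 * A rho ^+ 2 * rho ^+ 4)
    + s * (alpha0 * Z s rho / (lambda * rho))
    - s * (Z s rho ^+ 2 / (lambda * A rho * rho ^+ 3))
    - alpha0 * Q rho in
  let tcurve := fun rho : R =>
    Z 1 rho ^+ 2 / (2 * lambda * A rho ^+ 2 * rho ^+ 4)
    + Z 1 rho / rho * (1 - alpha0 / (lambda * rho * A rho))
    - alpha0 * rho * A rho + lambda * Q rho + t0 in
  open I -> is_interval I -> (forall rho, I rho -> 0 < rho) ->
  smooth_on I p -> (forall rho, I rho -> 0 < derive1 p rho) ->
  antiderivative_on I (fun rho => rho * A rho ^+ 2) Q ->
  antiderivative_on I Q intQ ->
  lambda != 0 ->
  caustic N = [set (tcurve rho, xcurve 1 rho) | rho in I]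
              `|` [set (tcurve rho, xcurve (-1) rho) | rho in I].
Proof.
move=> A N Z xcurve tcurve Iopen _ Ipos _ dp_gt0 dQ dJ lambda0.
have Apos r : I r -> 0 < A r.
  move=> Ir; rewrite /A mulr_gt0 ?invr_gt0 ?sqrtr_gt0;
    by [|exact: Ipos|exact: dp_gt0].
pose T := tsol intQ lambda alpha0 alpha2 t0.
pose X := xsol Q intQ lambda alpha0 alpha2 x0.
pose U := usol A Q intQ lambda alpha0 alpha2.
have NE : N = graph_over I T X by [].
have sing m : N m -> singular_points N m <->
    ucoord m = U 1 (rcoord m) \/ ucoord m = U (-1) (rcoord m).
  by move=> Nm; apply: singular_points_sol.
(* For [s] = 1, substitute K = Z_+ - alpha0 r^2 A. For [s] = -1 the value is the same, since lambda
   u^2 / 2 + alpha0 u = ((lambda u + alpha0)^2 - alpha0^2) / (2 lambda). *)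
have TU s r : I r -> s = 1 \/ s = -1 -> T (U s r) r = tcurve r.
  move=> Ir; have r0 := lt0r_neq0 (Ipos _ Ir).
  have A0 := lt0r_neq0 (Apos _ Ir).
  case=> ->; rewrite /T /tsol /U /usol /zsol /tcurve /Z; field;
    by rewrite r0 lambda0 A0.
(* Since s^2 = 1, K = s (Z_s - alpha0 r^2 A); the part u K / r of x then yields the two terms of
   [xcurve] that carry an explicit sign. *)
have XU s r : I r -> s = 1 \/ s = -1 -> X (U s r) r = xcurve s r.
  move=> Ir; have r0 := lt0r_neq0 (Ipos _ Ir).
  have A0 := lt0r_neq0 (Apos _ Ir).
  case=> ->; rewrite /X /xsol /U /usol /zsol /xcurve /Z; field;
    by rewrite r0 lambda0 A0.
have caust s r : I r -> s = 1 \/ s = -1 -> caustic N (tcurve r, xcurve s r).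
  move=> Ir s2; pose m : 'rV[R]_4 :=
    \row_(j < 4) nth 0 [:: tcurve r; xcurve s r; U s r; r] j.
  have [tm xm um rm] : [/\ tcoord m = tcurve r, xcoord m = xcurve s r,
      ucoord m = U s r & rcoord m = r].
    by split; rewrite /tcoord/xcoord/ucoord/rcoord mxE.
  exists m; last by rewrite tm xm.
  apply/sing; first by rewrite NE; split; rewrite ?tm ?xm ?um rm ?TU ?XU.
  by rewrite um rm; case: s2 => ->; [left|right].
have s1 : (1 : R) = 1 \/ (1 : R) = -1 by left.
have sN1 : (-1 : R) = 1 \/ (-1 : R) = -1 by right.
apply/seteqP; split=> [_ [m sm <-]|_ [[r Ir <-]|[r Ir <-]]]; last 2 first.
- exact: caust.
- exact: caust.
have Nm : N m by case: sm.
have [Ir tm xm] : graph_over I T X m by [].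
case/(sing m Nm): sm => um; [left|right]; exists (rcoord m) => //;
  by rewrite tm xm um TU ?XU.
Qed.
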